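(* Let $\mathcal{G}=(\mathcal{E},\mathcal{I},\Theta)$ be a GDatalog[$\Delta$] program and $I$ an input instance for $\mathcal{G}$ such that $\Omega_{\mathcal{G}}(I)=\Omega^{\mathsf{fin}}_{\mathcal{G}}(I)$, i.e. all possible outcomes of $I$ w.r.t. $\mathcal{G}$ are finite. Then $\Pr_{\mathcal{G},I}$, given by $\Pr_{\mathcal{G},I}(J)=\mathbf{P}(J)$, is a discrete probability function over $\Omega_{\mathcal{G}}(I)$.
   Context: Schemas, facts, instances. A schema is a collection of relation symbols $R$, each with an arity $\mathrm{arity}(R)\in\mathbb{N}$. A fact over a schema is an expression $R(c_1,\dots,c_n)$ with $R$ an $n$-ary symbol of the schema and $c_1,\dots,c_n\in\mathbb{R}$. An instance is a finite set of facts. An atom is $R(t_1,\dots,t_n)$ where each $t_i$ is a constant (real number) or a variable. Distributions. A parameterized numerical (discrete) distribution is a function $\delta:\Omega_\delta\times\mathbb{R}^k\to[0,1]$ with $\Omega_\delta\subseteq\mathbb{R}$ finite or countably infinite, such that $\sum_{o\in\Omega_\delta}\delta(o,\mathbf{p})=1$ for all $\mathbf{p}\in\mathbb{R}^k$; $k$ is denoted $\mathrm{pardim}(\delta)$. Write $\delta(o|\mathbf{p})$ for $\delta(o,\mathbf{p})$, and put $\delta(b|\mathbf{p})=0$ for $b\in\mathbb{R}\setminus\Omega_\delta$. GDatalog[$\Delta$]. Let $\Delta$ be a finite set of parameterized numerical distributions. A $\Delta$-term is $\delta[p_1,\dots,p_k]$ with $\delta\in\Delta$, $k=\mathrm{pardim}(\delta)$,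 each $p_i$ a variable or constant. A $\Delta$-atom is $R(t_1,\dots,t_n)$ where exactly one $t_i$ is a $\Delta$-term and all other $t_j$ are constants or variables. A GDatalog[$\Delta$] program is $\mathcal{G}=(\mathcal{E},\mathcal{I},\Theta)$ with $\mathcal{E},\mathcal{I}$ disjoint schemas and $\Theta$ a finite set of rules $\forall\mathbf{x}(\psi(\mathbf{x})\leftarrow\varphi(\mathbf{x}))$, where $\varphi$ is a conjunction of atoms over $\mathcal{E}\cup\mathcal{I}$, $\psi$ is an atom or a $\Delta$-atom over $\mathcal{I}$, and every variable of $\mathbf{x}$ occurs in $\varphi$. An input instance for $\mathcal{G}$ is an instance over $\mathcal{E}$. Associated program $\widehat{\mathcal{G}}=(\mathcal{E},\mathcal{I}^\Delta,\Theta^\Delta)$. $\mathcal{I}^\Delta$ extends $\mathcal{I}$ with a new ''distributional'' relation symbol $R^\delta_i$ of arity $\mathrm{arity}(R)+\mathrm{pardim}(\delta)$ whenever some rule of $\Theta$ contains a $\Delta$-atom over $R$ with a term $\delta[\dots]$ in position $i$. $\Theta^\Delta$ consists of: (a) all rules of $\Theta$ without $\Delta$-terms; (b) the rule $\exists y\,R^\delta_i(\mathbf{t},y,\mathbf{t}',\mathbf{p})\leftarrow\varphi(\mathbf{x})$ for every rule $R(\mathbf{t},\delta[\mathbf{p}],\mathbf{t}')\leftarrow\varphi(\mathbf{x})$ of $\Theta$ with $\delta[\mathbf{p}]$ in position $i$ ($y$ is then in position $i$); (c) the rule $R(\mathbf{x})\leftarrow R^\delta_i(\mathbf{x},\mathbf{p})$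 for every distributional symbol $R^\delta_i$. Possible outcomes. A solution of $I$ w.r.t. $\widehat{\mathcal{G}}$ is a possibly infinite set $J$ of facts over $\mathcal{E}\cup\mathcal{I}^\Delta$ with $I\subseteq J$ satisfying all rules of $\Theta^\Delta$ as first-order sentences; it is minimal if no proper subset of it is a solution. A possible outcome of $I$ w.r.t. $\mathcal{G}$ is a minimal solution $J$ such that $\delta(b|\mathbf{p})>0$ for every distributional fact $R^\delta_i(\mathbf{a},b,\mathbf{c},\mathbf{p})\in J$ with $b$ in position $i$. $\Omega_{\mathcal{G}}(I)$ is the set of all possible outcomes and $\Omega^{\mathsf{fin}}_{\mathcal{G}}(I)$ the set of finite ones. Weights. The weight of a distributional fact $R^\delta_i(a_1,\dots,a_n,\mathbf{p})$ is $\delta(a_i|\mathbf{p})$; every other fact has weight $1$. For a finite set $F$ of facts, $\mathbf{P}(F)=\prod_{f\in F}\mathrm{weight}(f)$. A discrete probability function over a finite or countably infinite set $\Omega$ is a map $\pi:\Omega\to[0,1]$ with $\sum_{o\in\Omega}\pi(o)=1$. *)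

(* Defs.v *)
From HB Require Import structures.
From mathcomp Require Import all_boot all_order all_algebra.
From mathcomp Require Import all_classical all_reals.
From mathcomp Require Import esum.
From Stdlib Require List.

Set Implicit Arguments.
Unset Strict Implicit.
Unset Printing Implicit Defensive.
Import Order.TTheory GRing.Theory Num.Theory.
Local Open Scope classical_set_scope.
Local Open Scope ring_scope.

(* [pi] is total on [T]; only its values on [Omega] matter. *)
Definition discrete_probability (R : realType) (T : choiceType)
    (Omega : set T) (pi : T -> R) : Prop :=
  [/\ countable Omega,
      forall o, Omega o -> 0 <= pi o <= 1
    & (\esum_(o in Omega) (pi o)%:E = 1)%E].

(* [mass d b p] is delta(b | p), with the convention that it is 0 when b lies
   outside the sample space. *)
Record pdist (R : realType) := PDist {
  sample_space : set R;
  pardim : nat;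
  mass : R -> pardim.-tuple R -> R;
  mass_prob : forall p, discrete_probability sample_space (mass^~ p);
  mass_out : forall b p, ~ sample_space b -> mass b p = 0 }.

Record schema := Schema { symbol :> Type; arity : symbol -> nat }.
Arguments arity {s} _ : rename.

(* Union of disjoint schemas. *)
Definition schema_union (S T : schema) : schema :=
  @Schema (S + T)%type
    (fun x => match x with inl s => arity s | inr t => arity t end).

Record fact (R : realType) (S : schema) := Fact {
  fact_sym : S;
  fact_args : (arity fact_sym).-tuple R }.
Arguments Fact {R S} fact_sym fact_args.

HB.instance Definition _ (R : realType) (S : schema) := gen_eqMixin (fact R S).
HB.instance Definition _ (R : realType) (S : schema) :=
  gen_choiceMixin (fact R S).

Definition fact_inl (R : realType) (S T : schema) (f : fact R S) :
    fact R (schema_union S T) :=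
  @Fact R (schema_union S T) (inl (fact_sym f)) (fact_args f).

Inductive term (R : realType) (V : Type) : Type :=
| Var of V
| Cst of R.
Arguments Var {R V} _.
Arguments Cst {R V} _.

Definition term_map (R : realType) (V W : Type) (h : V -> W) (t : term R V) :
    term R W :=
  match t with Var x => Var (h x) | Cst c => Cst c end.

Definition term_eval (R : realType) (V : Type) (v : V -> R) (t : term R V) : R :=
  match t with Var x => v x | Cst c => c end.

Definition term_vars (R : realType) (t : term R nat) : seq nat :=
  match t with Var x => [:: x] | Cst _ => [::] end.

Record atom (R : realType) (S : schema) (V : Type) := Atom {
  atom_sym : S;
  atom_args : (arity atom_sym).-tuple (term R V) }.
Arguments Atom {R S V} atom_sym atom_args.

Definition atom_inl (R : realType) (S T : schema) (V : Type) (a : atom R S V) :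
    atom R (schema_union S T) V :=
  @Atom R (schema_union S T) V (inl (atom_sym a)) (atom_args a).

Definition atom_inr (R : realType) (S T : schema) (V : Type) (a : atom R T V) :
    atom R (schema_union S T) V :=
  @Atom R (schema_union S T) V (inr (atom_sym a)) (atom_args a).

Definition atom_map (R : realType) (S : schema) (V W : Type) (h : V -> W)
    (a : atom R S V) : atom R S W :=
  Atom (atom_sym a) (map_tuple (term_map h) (atom_args a)).

Definition ground (R : realType) (S : schema) (V : Type) (v : V -> R)
    (a : atom R S V) : fact R S :=
  Fact (atom_sym a) (map_tuple (term_eval v) (atom_args a)).

Definition atom_vars (R : realType) (S : schema) (a : atom R S nat) : seq nat :=
  flatten [seq term_vars t | t <- atom_args a].

(* The tuple of size n having y in position i and the entries of t, in order,
   in the other positions. *)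
Definition insert_at (A : Type) (n : nat) (i : 'I_n) (y : A)
    (t : n.-1.-tuple A) : n.-tuple A :=
  [tuple if unlift i j is Some j' then tnth t j' else y | j < n].

(* [DeltaHead r i t d p] is the Delta-atom r(t, d[p], t') with the Delta-term
   in position i; the tuple t lists the other arity r - 1 arguments. *)
Inductive head (R : realType) (I : schema) : Type :=
| AtomHead of atom R I nat
| DeltaHead (r : I) (i : 'I_(arity r)) (t : (arity r).-1.-tuple (term R nat))
    (d : pdist R) (p : (pardim d).-tuple (term R nat)).
Arguments AtomHead {R I} _.
Arguments DeltaHead {R I} r i t d p.

Definition head_vars (R : realType) (I : schema) (h : head R I) : seq nat :=
  match h with
  | AtomHead a => atom_vars a
  | DeltaHead r i t d p =>
      flatten [seq term_vars u | u <- t] ++ flatten [seq term_vars u | u <- p]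
  end.

Record rule (R : realType) (E I : schema) := Rule {
  rule_head : head R I;
  rule_body : seq (atom R (schema_union E I) nat) }.
Arguments Rule {R E I} rule_head rule_body.

Definition head_over (R : realType) (I : schema) (Delta : set (pdist R))
    (h : head R I) : Prop :=
  match h with
  | AtomHead _ => True
  | DeltaHead _ _ _ d _ => Delta d
  end.

(* The schemas E and I are kept disjoint by working over their sum. *)
Record program (R : realType) (Delta : set (pdist R)) (E I : schema) := Program {
  rules : set (rule R E I);
  rules_finite : finite_set rules;
  rules_over : forall th, rules th -> head_over Delta (rule_head th);
  rules_safe : forall th, rules th ->
    {subset head_vars (rule_head th) <=
       flatten [seq atom_vars a | a <- rule_body th]} }.

(* The symbol R^delta_i. *)
Record dsymbol (R : realType) (I : schema) := DSymbol {
  dsym_base : I;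
  dsym_pos : 'I_(arity dsym_base);
  dsym_dist : pdist R }.
Arguments DSymbol {R I} dsym_base dsym_pos dsym_dist.

Definition dschema (R : realType) (I : schema) : schema :=
  @Schema (dsymbol R I)
    (fun s => (arity (dsym_base s) + pardim (dsym_dist s))%N).

(* All candidate distributional symbols are present in this type; the ones that
   belong to I^Delta are singled out by [in_IDelta]. *)
Definition hat_schema (R : realType) (E I : schema) : schema :=
  schema_union (schema_union E I) (dschema R I).

Definition in_IDelta (R : realType) (Delta : set (pdist R)) (E I : schema)
    (G : program Delta E I) (s : dschema R I) : Prop :=
  exists t p body,
    rules G (Rule (DeltaHead (dsym_base s) (dsym_pos s) t (dsym_dist s) p) body).

Definition facts_over (R : realType) (Delta : set (pdist R)) (E I : schema)
    (G : program Delta E I) : set (fact R (hat_schema R E I)) :=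
  [set f | match fact_sym f : hat_schema R E I with
           | inl _ => True
           | inr s => in_IDelta G s
           end].

(* The sentence "forall x, (exists y, head) <- body", where the variables x are
   the numbers and y is [None]. If y does not occur in the head, this is the
   ordinary rule. *)
Record xrule (R : realType) (S : schema) := XRule {
  xrule_head : atom R S (option nat);
  xrule_body : seq (atom R S nat) }.
Arguments XRule {R S} xrule_head xrule_body.

Definition satisfies (R : realType) (S : schema) (J : set (fact R S))
    (th : xrule R S) : Prop :=
  forall v : nat -> R,
    (forall a, List.In a (xrule_body th) -> J (ground v a)) ->
    exists y : R, J (ground (oapp v y) (xrule_head th)).

(* R^delta_i(t, y, t', p) *)
Definition hat_head (R : realType) (I : schema) (r : I) (i : 'I_(arity r))
    (t : (arity r).-1.-tuple (term R nat)) (d : pdist R)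
    (p : (pardim d).-tuple (term R nat)) : atom R (dschema R I) (option nat) :=
  @Atom R (dschema R I) (option nat) (DSymbol r i d)
    (cat_tuple (insert_at i (Var None) (map_tuple (term_map Some) t))
               (map_tuple (term_map Some) p)).

(* R^delta_i(x, p), where x and p are the variables numbered from 0 *)
Definition proj_body (R : realType) (I : schema) (s : dschema R I) :
    atom R (dschema R I) nat :=
  Atom s [tuple Var (j : nat) | j < arity s].

(* R(x) *)
Definition proj_head (R : realType) (I : schema) (s : dschema R I) :
    atom R I (option nat) :=
  Atom (dsym_base s) [tuple Var (Some (j : nat)) | j < arity (dsym_base s)].

(* The rules Theta^Delta of the associated program. *)
Inductive hat_rules (R : realType) (Delta : set (pdist R)) (E I : schema)
    (G : program Delta E I) : set (xrule R (hat_schema R E I)) :=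
| hat_plain a body :
    rules G (Rule (AtomHead a) body) ->
    hat_rules G
      (XRule (atom_inl _ (atom_inr E (atom_map Some a)))
             [seq atom_inl _ b | b <- body])
| hat_exists r i t d p body :
    rules G (Rule (DeltaHead r i t d p) body) ->
    hat_rules G
      (XRule (atom_inr _ (hat_head i t p))
             [seq atom_inl _ b | b <- body])
| hat_proj s :
    in_IDelta G s ->
    hat_rules G
      (XRule (atom_inl _ (atom_inr E (proj_head s)))
             [:: atom_inr _ (proj_body s)]).

Definition solution (R : realType) (Delta : set (pdist R)) (E I : schema)
    (G : program Delta E I) (D : set (fact R E)) :
    set (set (fact R (hat_schema R E I))) :=
  [set J | [/\ J `<=` facts_over G,
               [set fact_inl _ (fact_inl _ f) | f in D] `<=` J
             & forall th, hat_rules G th -> satisfies J th]].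

Definition minimal_solution (R : realType) (Delta : set (pdist R))
    (E I : schema) (G : program Delta E I) (D : set (fact R E)) :
    set (set (fact R (hat_schema R E I))) :=
  [set J | solution G D J /\ forall J', J' `<` J -> ~ solution G D J'].

(* The fact R^delta_i(a_1, ..., a_n, p) carries the value delta(a_i | p). *)
Definition dfact_mass (R : realType) (I : schema) (s : dschema R I)
    (a : (arity s).-tuple R) : R :=
  mass (tnth a (lshift (pardim (dsym_dist s)) (dsym_pos s)))
       [tuple tnth a (rshift (arity (dsym_base s)) j)
         | j < pardim (dsym_dist s)].

Definition weight (R : realType) (E I : schema)
    (f : fact R (hat_schema R E I)) : R :=
  match f with
  | Fact s a =>
      match s return (@arity (hat_schema R E I) s).-tuple R -> R with
      | inl _ => fun=> 1
      | inr s' => fun a' => @dfact_mass R I s' a'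
      end a
  end.

Definition possible_outcomes (R : realType) (Delta : set (pdist R))
    (E I : schema) (G : program Delta E I) (D : set (fact R E)) :
    set (set (fact R (hat_schema R E I))) :=
  [set J | minimal_solution G D J /\
    forall (s : dschema R I) (a : (arity s).-tuple R),
      J (@Fact R (hat_schema R E I) (inr s) a) -> 0 < dfact_mass a].

Definition finite_outcomes (R : realType) (Delta : set (pdist R))
    (E I : schema) (G : program Delta E I) (D : set (fact R E)) :
    set (set (fact R (hat_schema R E I))) :=
  [set J | possible_outcomes G D J /\ finite_set J].

(* Meaningful for finite J only. *)
Definition prob (R : realType) (E I : schema)
    (J : set (fact R (hat_schema R E I))) : R :=
  \big[*%R/1]_(f \in J) weight f.

(* Main.v *)
(* Minimal solutions are exactly the chases of choice functions: fix one sample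
   value per trigger (a distributional symbol with all its arguments except the
   sampled one) and close the input under the rules.  For a finite set C of
   sampled facts of a partial run, the total probability of the outcomes
   containing C is the product of the weights of C.  Indeed, if every trigger
   fired by the chase of C already has a value in C, the only such outcome is
   that chase; otherwise split according to the value b of one unsampled trigger,
   whose probabilities sum to 1, and pass to C plus the fact sampling b.  This
   recursion is well founded, since an infinite branch would give an infinite
   possible outcome.  The theorem is the case C = set0. *)
Require Import Defs.
From mathcomp Require Import all_boot all_order all_algebra.
From mathcomp Require Import all_classical all_reals.
From mathcomp Require Import ereal esum.

Set Implicit Arguments.
Unset Strict Implicit.
Unset Printing Implicit Defensive.
Import Order.TTheory GRing.Theory Num.Theory.
Local Open Scope classical_set_scope.
Local Open Scope ring_scope.

(** * Extended sums, infinite chains of sets and finite products *)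

(** For positive factors one inequality suffices: applied to the factor [r^-1] and the function
    [r * f], it yields the converse. *)
Lemma esumZl (R : realType) (T : choiceType) (A : set T) (r : R) (f : T -> R) :
  0 <= r -> (forall i, 0 <= f i) ->
  (\esum_(i in A) (r * f i)%:E = r%:E * \esum_(i in A) (f i)%:E)%E.
Proof.
move=> r0 f0.
have le_esumZl s (g : T -> R) : 0 < s -> (forall i, 0 <= g i) ->
    (\esum_(i in A) (s * g i)%:E <= s%:E * \esum_(i in A) (g i)%:E)%E.
  move=> s0 g0; apply: ge_ereal_sup => _ [X XA <-].
  under eq_fsbigr do rewrite EFinM.
  rewrite -ge0_mule_fsumr => [|i]; last by rewrite lee_fin.
  by rewrite lee_pmul2l ?lte_fin//; apply: ereal_sup_ubound; exists X.
move: r0; rewrite le_eqVlt => /predU1P[<-|r0].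
  by rewrite mul0e esum1// => i _; rewrite mul0r.
apply/eqP; rewrite eq_le le_esumZl//=.
rewrite -(@lee_pmul2l _ r^-1%:E) ?lte_fin ?invr_gt0//.
rewrite muleA -EFinM mulVf ?gt_eqF// mul1e.
under eq_esum do rewrite -[f _](mulKf (lt0r_neq0 r0)).
by apply: le_esumZl => [|i]; rewrite ?invr_gt0// mulr_ge0// ltW.
Qed.

(* [esum_bigcupT] for families indexed by any choice type instead of [nat]. *)
Lemma esum_bigcup_trivIset (R : realType) (I T : choiceType) (A : set I)
    (B : I -> set T) (f : T -> \bar R) :
  trivIset A B -> (forall x, 0 <= f x)%E ->
  (\esum_(x in \bigcup_(i in A) B i) f x =
   \esum_(i in A) \esum_(x in B i) f x)%E.
Proof.
move=> tB f0; rewrite esum_esum//; apply: reindex_esum; split.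
- by move=> [i x] [/= Ai Bix]; exists i.
- move=> [i x] [j y]; rewrite !inE => -[/= Ai Bix] [/= Aj Bjy] xy.
  by congr (_, _) => //; apply: tB => //; exists x; split=> //; rewrite xy.
- by move=> x [i Ai Bix]; exists (i, x).
Qed.

(** Dependent choice on the one-element enlargements. The element added at a stage is missing before
    it and present ever after, so the added elements are pairwise distinct. This gives the
    well-foundedness of the branching recursion. *)
Lemma strict_chain (T : Type) (bad : set (set T)) (A0 : set T) :
    bad A0 ->
    (forall A, bad A -> exists2 x, ~ A x & bad (x |` A)) ->
  exists A : nat -> set T,
    [/\ forall n, bad (A n), {homo A : m n / (m <= n)%N >-> m `<=` n}
      & infinite_set (\bigcup_n A n)].
Proof.
move=> bad0 step.
pose next (A B : {A | bad A}) :=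
  exists x, ~ sval A x /\ sval B = x |` sval A.
have nextP A : {B | next A B}.
  apply: cid; case: A => A badA.
  by have [x Ax badx] := step _ badA; exists (exist _ _ badx), x.
have [A [_ /= nA]] := dependent_choice nextP (exist _ _ bad0).
have homoA : {homo (sval \o A) : m n / (m <= n)%N >-> m `<=` n}.
  apply: homo_leq => [B|B C D|n /= a Aa]; [exact: subset_refl|exact: subset_trans|].
  by have [x [_ ->]] := nA n; right.
exists (sval \o A); split=> //; first by move=> n; exact: svalP.
have [x xP] := choice nA => finU.
have x_inj : injective x.
  move=> m n; wlog mn : m n / (m <= n)%N => [hw|].
    by have [/hw//|/ltnW/hw h /esym/h] := leqP m n.
  move: mn; rewrite leq_eqVlt => /predU1P[//|mn] xmn.
  have [+ _] := xP n; rewrite -xmn; case.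
  by apply: (homoA _ _ mn) => /=; rewrite (xP m).2; left.
apply: infinite_nat; apply: sub_finite_set (finite_preimage _ finU).
  by move=> n _; exists n.+1 => //=; rewrite (xP n).2; left.
by move=> ? ? _ _; exact: x_inj.
Qed.

Lemma fsprod_ge0 (R : realType) (T : choiceType) (A : set T) (f : T -> R) :
  (forall i, 0 <= f i) -> 0 <= \big[*%R/1]_(i \in A) f i.
Proof. by move=> f0; apply: prodr_ge0. Qed.

Lemma fsprod_le1 (R : realType) (T : choiceType) (A : set T) (f : T -> R) :
  (forall i, 0 <= f i <= 1) -> \big[*%R/1]_(i \in A) f i <= 1.
Proof. by move=> f01; apply: prodr_ile1. Qed.

(** * The chase over abstract facts and triggers *)

Section Chase.
(** Intended reading: [mk k y] is the fact recording the sample [y] at the trigger [k], [det A]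
    consists of the facts that [A] yields in one deterministic step, and [trig A] of the triggers
    that [A] fires. *)
Variables (F V : choiceType) (K : Type) (mk : K -> V -> F).
Hypothesis mk_inj : forall k y k' y', mk k y = mk k' y' -> k = k' /\ y = y'.

Variables (det : set F -> set F) (trig : set F -> set K).
Hypothesis det_mono : forall A B, A `<=` B -> det A `<=` det B.
Hypothesis trig_mono : forall A B, A `<=` B -> trig A `<=` trig B.
Hypothesis det_mk : forall A k y, ~ det A (mk k y).

(** A fired trigger without a value in [C] imposes nothing, so the least closed set can describe a
    run that still awaits samples. *)
Definition closed_under (C X : set F) : Prop :=
  det X `<=` X /\ forall k y, trig X k -> C (mk k y) -> X (mk k y).

Definition chase (C : set F) : set F :=
  [set f | forall X, closed_under C X -> X f].

Definition graph (c : K -> V) : set F := [set mk k (c k) | k in [set: K]].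

Lemma graph_mk c k y : graph c (mk k y) -> y = c k.
Proof. by move=> [k' _ /mk_inj[-> ->]]. Qed.

Lemma chase_min C X : closed_under C X -> chase C `<=` X.
Proof. by move=> CX f; exact. Qed.

Lemma chase_closed C : closed_under C (chase C).
Proof.
split=> [f df X CX|k y tk Cy X CX].
  by apply: CX.1; apply: det_mono df; exact: chase_min.
by apply: CX.2 => //; apply: trig_mono tk; exact: chase_min.
Qed.

Lemma chase_mono C C' : C `<=` C' -> chase C `<=` chase C'.
Proof.
move=> CC'; apply: chase_min; have [d t] := chase_closed C'.
by split=> // k y tk /CC'; exact: t.
Qed.

(** Discarding from the chase all sampled facts outside [C] leaves a closed set, because [det] never
    produces a sampled fact. *)
Lemma chase_mk C k y : chase C (mk k y) -> C (mk k y).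
Proof.
have [d t] := chase_closed C.
suff /chase_min/[apply] : closed_under C (chase C `&` [set f |
  forall k y, f = mk k y -> C f]) by case=> _ /(_ _ _ erefl).
split=> [f df|k' y' tk' Cy'].
  split; first by apply: d; apply: det_mono df; exact: subIsetl.
  by move=> k' y' fE; move: df; rewrite fE => /det_mk.
split=> //; apply: t => //; apply: trig_mono tk'; exact: subIsetl.
Qed.

(** * Minimal solutions as chases of choice functions *)

Section Solutions.
Variable U : set F.
Hypothesis det_U : forall A, det A `<=` U.
Hypothesis trig_U : forall A k y, trig A k -> U (mk k y).

Definition chase_solution (J : set F) : Prop :=
  [/\ J `<=` U, det J `<=` J & forall k, trig J k -> exists y, J (mk k y)].

Lemma chase_graph_solution c : chase_solution (chase (graph c)).
Proof.
have [d t] := chase_closed (graph c); split=> // [|k tk].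
  by apply: chase_min; split=> [|k y tk _]; [exact: det_U|exact: trig_U tk].
by exists (c k); apply: t => //; exists k.
Qed.

Lemma minimal_chase_solutionP J : inhabited V ->
  (chase_solution J /\ forall J', J' `<` J -> ~ chase_solution J') <->
  exists c, J = chase (graph c).
Proof.
move=> [y0]; split=> [[[JU dJ tJ] Jmin]|[c ->]].
  have /choice[c cP] : forall k, exists y, trig J k -> J (mk k y).
    move=> k; have [/tJ[y Jy]|ntk] := pselect (trig J k); first by exists y.
    (* A trigger not fired by [J] gets an arbitrary value; the chase stays inside [J] and never
       consults it. *)
    by exists y0.
  have LJ : chase (graph c) `<=` J.
    by apply: chase_min; split=> // k y tk /graph_mk ->; exact: cP.
  exists c; apply: contrapT => JL; apply: (Jmin (chase (graph c))).
    by split=> // sJ; apply: JL; apply/seteqP.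
  exact: chase_graph_solution.
split=> [|J' [J'L nLJ'] [_ dJ' tJ']]; first exact: chase_graph_solution.
(* The smaller solution is closed under the same choices: its value at a fired trigger is a sample
   of the chase, hence equal to [c k]. *)
apply: nLJ'; apply: chase_min; split=> // k y tk /graph_mk ->.
have [y' J'y'] := tJ' _ tk.
by have /J'L/chase_mk/graph_mk <- := J'y'.
Qed.

End Solutions.

(** * Probability of the outcomes extending a partial run *)

Variable R : realType.
Variables (S : K -> set V) (w : K -> V -> R) (wt : F -> R).
Hypothesis w_prob : forall k, discrete_probability (S k) (w k).
Hypothesis w_out : forall k y, ~ S k y -> w k y = 0.
Hypothesis wt_mk : forall k y, wt (mk k y) = w k y.
Hypothesis wt_det : forall f, (forall k y, f <> mk k y) -> wt f = 1.

Definition outcome (J : set F) : Prop :=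
  (exists c, J = chase (graph c)) /\ forall k y, J (mk k y) -> 0 < w k y.

Hypothesis outcome_finite : forall J, outcome J -> finite_set J.

Lemma w01 k y : 0 <= w k y <= 1.
Proof.
have [Sy|/w_out ->] := pselect (S k y); last by rewrite lexx ler01.
by have [_ /(_ _ Sy)] := w_prob k.
Qed.

Lemma wt01 f : 0 <= wt f <= 1.
Proof.
have [[[k y] /= ->]|nf] := pselect (exists ky : K * V, f = mk ky.1 ky.2).
  by rewrite wt_mk w01.
by rewrite wt_det ?lexx ?ler01// => k y fE; apply: nf; exists (k, y).
Qed.

Let P (A : set F) : R := \big[*%R/1]_(f \in A) wt f.

(** Values of mass zero add nothing, so branching may be restricted to the values that an outcome is
    allowed to contain. *)
Lemma w_pos_esum k : (\esum_(y in [set y | (0 < w k y)%R]) (w k y)%:E = 1)%E.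
Proof.
have [_ _ <-] := w_prob k.
transitivity (\esum_(y in S k `&` [set y | (0 < w k y)%R]) (w k y)%:E)%E.
  congr esum; apply/esym/setIidPr => y /= wy; apply: contrapT => /w_out wy0.
  by rewrite wy0 ltxx in wy.
rewrite esum_mkcondr; apply: eq_esum => y _; case: ifPn => //.
have /andP[w0 _] := w01 k y.
by rewrite notin_setE/= lt_neqAle w0 andbT => /negP/negPn/eqP <-.
Qed.

Lemma w_pos_exists k : exists y, 0 < w k y.
Proof.
apply/not_existsP => w0; have := w_pos_esum k.
by rewrite esum1 => [/esym/eqP|y /w0//]; rewrite onee_eq0.
Qed.

(* The sampled facts of a partial run of the chase. *)
Definition state (C : set F) : Prop :=
  [/\ forall f, C f -> exists k y, f = mk k y /\ 0 < w k y,
      forall k y y', C (mk k y) -> C (mk k y') -> y = y'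
    & C `<=` chase C].

(** Keep the values recorded in [C] and pick some value of positive mass at every other trigger. *)
Lemma state_graph C : state C ->
  exists2 c, C `<=` graph c & forall k, 0 < w k (c k).
Proof.
move=> [Cmk Cfun _].
have /choice[c cP] : forall k, exists y,
    0 < w k y /\ forall y', C (mk k y') -> y' = y.
  move=> k; have [[y Cy]|nC] := pselect (exists y, C (mk k y)).
    exists y; split=> [|y' Cy']; last exact: Cfun Cy' Cy.
    by have [k' [y' [/mk_inj[-> ->]]]] := Cmk _ Cy.
  by have [y wy] := w_pos_exists k; exists y; split=> // y' Cy'; case: nC; exists y'.
exists c => [f Cf|k]; last by have [] := cP k.
have [k [y [fE _]]] := Cmk _ Cf; subst f; exists k => //.
by have [_ /(_ _ Cf) <-] := cP k.
Qed.

Lemma chase_graph_outcome c : (forall k, 0 < w k (c k)) ->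
  outcome (chase (graph c)).
Proof.
by move=> cP; split=> [|k y /chase_mk/graph_mk ->//]; exists c.
Qed.

Lemma state_outcome C : state C -> exists2 J, outcome J & C `<=` J.
Proof.
move=> sC; have [c Cc cP] := state_graph sC.
exists (chase (graph c)); first exact: chase_graph_outcome.
by have [_ _ CL] := sC; apply: (subset_trans CL); exact: chase_mono.
Qed.

(** A state lies inside an outcome, and outcomes are finite by hypothesis. *)
Lemma state_finite C : state C -> finite_set C.
Proof.
by move=> /state_outcome[J /outcome_finite Jfin CJ]; exact: sub_finite_set Jfin.
Qed.

Definition extensions (C : set F) : set (set F) := [set J | outcome J /\ C `<=` J].

Lemma chase_sub_extension C J : extensions C J -> chase C `<=` J.
Proof.
move=> [[[c JE] _] CJ]; apply: chase_min; split=> [|k y _]; last exact: CJ.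
by rewrite JE; exact: (chase_closed _).1.
Qed.

(** Countability is carried along with the sum because [discrete_probability] demands both. *)
Definition good (C : set F) : Prop :=
  countable (extensions C) /\ (\esum_(J in extensions C) (P J)%:E = (P C)%:E)%E.

(** An outcome containing [C] has one value per trigger, so at each trigger fired by [chase C] it
    must use the value in [C]. Hence [chase C] is the only such outcome. *)
Lemma good_saturated C : state C ->
  (forall k, trig (chase C) k -> exists y, C (mk k y)) -> good C.
Proof.
move=> sC sat; have [Cmk Cfun CL] := sC; have [Ld Lt] := chase_closed C.
have extE : extensions C = [set chase C].
  have ext1 J : extensions C J -> J = chase C.
    move=> eJ; apply/seteqP; split; last exact: chase_sub_extension.
    have [[[c JE] _] CJ] := eJ; rewrite {1}JE; apply: chase_min; split=> // k y tk.
    have [y' Cy'] := sat _ tk => /graph_mk ->.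
    by have /CJ := Cy'; rewrite JE => /chase_mk/graph_mk <-; exact: CL.
  apply/seteqP; split=> [J /ext1//|_ ->].
  by have [J oJ CJ] := state_outcome sC; rewrite -(ext1 J).
split; first by rewrite extE; exact: countable1.
rewrite extE esum_set1; last by rewrite lee_fin fsprod_ge0// => f; case/andP: (wt01 f).
(* Facts of the chase outside [C] are not samples, so they have weight 1. *)
congr (_%:E); apply/esym/fsbig_widen => // f [Lf nCf] /=.
by apply: wt_det => k y fE; apply: nCf; rewrite fE; apply: chase_mk; rewrite -fE.
Qed.

Lemma good_branch C k : state C -> trig (chase C) k ->
  (forall y, ~ C (mk k y)) ->
  (forall y, 0 < w k y -> good (mk k y |` C)) -> good C.
Proof.
move=> sC tk nC gC.
(* Every extension of [C] contains [chase C], therefore fires [k] and contains a sample for it. *)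
have extE : extensions C =
    \bigcup_(y in [set y | 0 < w k y]) extensions (mk k y |` C).
  apply/seteqP; split=> [J eJ|J [y _ [oJ CJ]]]; last first.
    by split=> // f Cf; apply: CJ; right.
  have LJ := chase_sub_extension eJ; have [[[c JE] Jw] CJ] := eJ.
  have Jc : J (mk k (c k)).
    rewrite JE; apply: (chase_closed _).2; last by exists k.
    by rewrite -JE; apply: trig_mono tk.
  exists (c k); first exact: Jw Jc.
  by split; [exact: eJ.1|move=> f [->//|/CJ]].
have [cS _ _] := w_prob k.
split.
  rewrite extE; apply: bigcup_countable => [|y /gC[]//].
  apply: sub_countable cS; apply: subset_card_le => y /= wy.
  by apply: contrapT => /w_out wy0; rewrite wy0 ltxx in wy.
have P0 A : (0 <= (P A)%:E)%E.
  by rewrite lee_fin fsprod_ge0// => f; case/andP: (wt01 f).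
(* The branches are disjoint: an outcome is the chase of a graph and has at most one value at
   [k]. *)
rewrite extE esum_bigcup_trivIset//; last first.
  move=> y y' _ _ [J [[[[c JE] _] CJ] [_ CJ']]].
  have /graph_mk -> : graph c (mk k y) by apply: chase_mk; rewrite -JE; apply: CJ; left.
  have /graph_mk -> // : graph c (mk k y') by apply: chase_mk; rewrite -JE; apply: CJ'; left.
(* The new sample is not in the finite set [C], so it multiplies the weight of [C] by [w k y]. *)
transitivity (\esum_(y in [set y | (0 < w k y)%R]) (P C * w k y)%:E)%E.
  apply: eq_esum => y /gC[_ ->]; congr (_%:E); rewrite /P.
  have finC : finite_set (mk k y |` C).
    by rewrite finite_setU; split=> //; exact: state_finite.
  rewrite (fsbigD1 (mk k y) _ _ finC); last by left.
  rewrite wt_mk mulrC; congr (_ * _); apply: eq_fsbigl.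
  rewrite setDUl setDv set0U; apply/setDidl/seteqP; split=> // f [/= Cf fE].
  by case: (nC y); rewrite -fE.
rewrite esumZl ?w_pos_esum ?mule1//; first by rewrite -lee_fin.
by move=> y; case/andP: (w01 k y).
Qed.

Lemma state_add C k y : state C -> trig (chase C) k ->
  (forall y, ~ C (mk k y)) -> 0 < w k y -> state (mk k y |` C).
Proof.
move=> [Cmk Cfun CL] tk nC wy.
have LL : chase C `<=` chase (mk k y |` C) by apply: chase_mono; right.
split=> [f [->|/Cmk//]|k' y1 y2|f [->|/CL/LL//]].
- by exists k, y.
- move=> [/mk_inj[-> ->]|C1] [/mk_inj[k'k ->]|C2] //.
  + by case: (nC y2).
  + by case: (nC y1); rewrite -k'k.
  + exact: Cfun C1 C2.
- by apply: (chase_closed _).2; [exact: trig_mono tk|left].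
Qed.

(** A state that is not good has an unsampled fired trigger and, at it, a value whose addition is
    again not good. Iterating would produce an infinite state. *)
Lemma good_state C : state C -> good C.
Proof.
move=> sC; apply: contrapT => gC.
have [|//|A [sA homoA]] := @strict_chain F [set C | state C /\ ~ good C] C.
  by [].
- move=> {gC} {}C [{}sC gC].
  have [k [tk nC]] : exists k, trig (chase C) k /\ forall y, ~ C (mk k y).
    apply: contrapT => nk; apply: gC; apply: good_saturated => // k tk.
    by apply: contrapT => nC; apply: nk; exists k; split=> // y Cy; apply: nC; exists y.
  have [y [wy gy]] : exists y, 0 < w k y /\ ~ good (mk k y |` C).
    apply: contrapT => ny; apply: gC; apply: (good_branch sC tk nC) => y wy.
    by apply: contrapT => gy; apply: ny; exists y.
  by exists (mk k y); [exact: nC|split=> //; exact: state_add].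
(* The union of the chain is a state: two samples already occur together at the later of their
   stages, and the chase is monotone. *)
apply; apply: state_finite; split=> [f [n _ Af]|k y y' [n _ An] [m _ Am]|f [n _ Af]].
- by have [[/(_ _ Af)]] := sA n.
- have [[_ Afun _] _] := sA (maxn n m).
  by apply: (Afun k); [apply: homoA An|apply: homoA Am]; rewrite ?leq_maxl ?leq_maxr.
- have [[_ _ /(_ _ Af) Lf] _] := sA n.
  by apply: chase_mono Lf => g Ag; exists n.
Qed.

Lemma outcome_probability : discrete_probability outcome P.
Proof.
have [|cO sO] := @good_state set0; first by split.
have extE : extensions set0 = outcome.
  by apply/seteqP; split=> [J []|J oJ] //; split.
rewrite extE in cO sO; split=> //.
  move=> J _; rewrite fsprod_ge0 => [|f]; last by case/andP: (wt01 f).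
  by rewrite fsprod_le1// => f; exact: wt01.
by rewrite sO /P fsbig_set0.
Qed.

End Chase.

(** * Tuples with one distinguished position *)

Lemma insert_at_id (A : Type) n (i : 'I_n) (y : A) t :
  tnth (insert_at i y t) i = y.
Proof. by rewrite tnth_mktuple unlift_none. Qed.

Lemma insert_at_lift (A : Type) n (i : 'I_n) (y : A) t j :
  tnth (insert_at i y t) (lift i j) = tnth t j.
Proof. by rewrite tnth_mktuple liftK. Qed.

Lemma insert_atK (A : Type) n (i : 'I_n) (a : n.-tuple A) :
  insert_at i (tnth a i) [tuple tnth a (lift i j) | j < n.-1] = a.
Proof.
apply: eq_from_tnth => j; rewrite tnth_mktuple.
by case: unliftP => [j' ->|->//]; rewrite tnth_mktuple.
Qed.

Lemma map_insert_at (A B : Type) n (h : A -> B) (i : 'I_n) (y : A) t :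
  map_tuple h (insert_at i y t) = insert_at i (h y) (map_tuple h t).
Proof.
apply: eq_from_tnth => j; rewrite tnth_map !tnth_mktuple.
by case: unlift => // j'; rewrite tnth_map.
Qed.

Lemma map_cat_tuple (A B : Type) m n (h : A -> B) (s : m.-tuple A) (t : n.-tuple A) :
  map_tuple h (cat_tuple s t) = cat_tuple (map_tuple h s) (map_tuple h t).
Proof. by apply: val_inj => /=; rewrite map_cat. Qed.

Lemma cat_tuple_split (A : Type) m n (a : (m + n).-tuple A) :
  cat_tuple [tuple tnth a (lshift n j) | j < m] [tuple tnth a (rshift m j) | j < n] = a.
Proof.
apply: eq_from_tnth => j; case: (split_ordP j) => k ->.
  by rewrite tnth_lshift tnth_mktuple.
by rewrite tnth_rshift tnth_mktuple.
Qed.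

(** * The associated program as an instance of the chase *)

Section Datalog.
Variables (R : realType) (Delta : set (pdist R)) (E I : schema).
Variables (G : program Delta E I) (D : set (fact R E)).

Local Notation hfact := (fact R (hat_schema R E I)).

(* R^delta_i together with all arguments of a distributional fact except the
   sampled one. *)
Record trigger := Trigger {
  trig_sym : dsymbol R I;
  trig_args : (arity (dsym_base trig_sym)).-1.-tuple R;
  trig_params : (pardim (dsym_dist trig_sym)).-tuple R }.

Definition dist_args (s : dsymbol R I) (t : (arity (dsym_base s)).-1.-tuple R)
    (p : (pardim (dsym_dist s)).-tuple R) (y : R) :
    (@arity (dschema R I) s).-tuple R :=
  cat_tuple (insert_at (dsym_pos s) y t) p.

Definition dist_fact (k : trigger) (y : R) : hfact :=
  @Fact R (hat_schema R E I) (inr (trig_sym k))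
    (dist_args (trig_args k) (trig_params k) y).

Definition trigger_of (s : dsymbol R I) (a : (@arity (dschema R I) s).-tuple R) :
    trigger :=
  @Trigger s
    [tuple tnth a (lshift (pardim (dsym_dist s)) (lift (dsym_pos s) j)) | j < _]
    [tuple tnth a (rshift (arity (dsym_base s)) j) | j < _].

Definition sampled (s : dsymbol R I) (a : (@arity (dschema R I) s).-tuple R) : R :=
  tnth a (lshift (pardim (dsym_dist s)) (dsym_pos s)).

Lemma dist_args_trigger s a :
  dist_args (trig_args (@trigger_of s a)) (trig_params (trigger_of a)) (sampled a) = a.
Proof.
rewrite -[RHS]cat_tuple_split /dist_args; congr cat_tuple.
rewrite -[RHS](insert_atK (dsym_pos s)) tnth_mktuple; congr insert_at.
by apply: eq_from_tnth => j; rewrite !tnth_mktuple.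
Qed.

Lemma trigger_of_dist_args s t p y :
  trigger_of (@dist_args s t p y) = Trigger t p.
Proof.
congr Trigger; apply: eq_from_tnth => j; rewrite tnth_mktuple.
  by rewrite tnth_lshift insert_at_lift.
by rewrite tnth_rshift.
Qed.

Lemma sampled_dist_args s t p y : sampled (@dist_args s t p y) = y.
Proof. by rewrite /sampled tnth_lshift insert_at_id. Qed.

(** A left inverse of [dist_fact], giving injectivity without equations between dependently typed
    tuples. *)
Definition sample_of (f : hfact) : option (trigger * R) :=
  match f with
  | Fact s a =>
      match s return (@arity (hat_schema R E I) s).-tuple R -> _ with
      | inl _ => fun=> None
      | inr s' => fun a' => Some (@trigger_of s' a', @sampled s' a')
      end a
  end.

Lemma sample_of_dist_fact k y : sample_of (dist_fact k y) = Some (k, y).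
Proof.
by case: k => s t p; rewrite /= trigger_of_dist_args sampled_dist_args.
Qed.

Lemma dist_fact_inj k y k' y' :
  dist_fact k y = dist_fact k' y' -> k = k' /\ y = y'.
Proof. by move/(congr1 sample_of); rewrite !sample_of_dist_fact => -[]. Qed.

Lemma dist_factE s a :
  @Fact R (hat_schema R E I) (inr s) a = dist_fact (trigger_of a) (sampled a).
Proof. by congr Fact; exact/esym/dist_args_trigger. Qed.

Definition trigger_mass (k : trigger) (y : R) : R := mass y (trig_params k).

Lemma dfact_mass_trigger s a :
  @dfact_mass R I s a = trigger_mass (trigger_of a) (sampled a).
Proof. by []. Qed.

Lemma weight_dist_fact k y : weight (dist_fact k y) = trigger_mass k y.
Proof.
case: k => s t p /=.
by rewrite dfact_mass_trigger trigger_of_dist_args sampled_dist_args.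
Qed.

Lemma ground_hat_head v y r i t d p :
  ground (oapp v y) (atom_inr _ (@hat_head R I r i t d p)) =
  dist_fact (@Trigger (DSymbol r i d)
    (map_tuple (term_eval v) t) (map_tuple (term_eval v) p)) y.
Proof.
congr Fact; rewrite /dist_args map_cat_tuple map_insert_at.
by congr cat_tuple; [congr insert_at|]; apply: eq_from_tnth => j;
  rewrite !tnth_map; case: (tnth _ _).
Qed.

(** Covers the plain and the projection rules. Input facts follow from every set, so closed sets
    contain them; [y] is a dummy value for the absent existential variable. *)
Inductive det (J : set hfact) : set hfact :=
| det_input f : D f -> det J (fact_inl _ (fact_inl _ f))
| det_rule h body v y :
    hat_rules G (XRule (atom_inl _ h) body) ->
    (forall b, List.In b body -> J (ground v b)) ->
    det J (ground (oapp v y) (atom_inl _ h)).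

(** A trigger forgets its rule and valuation: heads that ground to the same symbol and arguments
    share one sample. *)
Inductive trig (J : set hfact) : set trigger :=
| trig_rule r i t d p body v :
    rules G (Rule (DeltaHead r i t d p) body) ->
    (forall b, List.In b [seq atom_inl (dschema R I) b | b <- body] -> J (ground v b)) ->
    trig J (@Trigger (DSymbol r i d)
      (map_tuple (term_eval v) t) (map_tuple (term_eval v) p)).

Lemma det_mono A B : A `<=` B -> det A `<=` det B.
Proof.
move=> AB f [g Dg|h body v y rh Abody]; first exact: det_input.
by apply: det_rule rh _ => b /Abody/AB.
Qed.

Lemma trig_mono A B : A `<=` B -> trig A `<=` trig B.
Proof.
by move=> AB k [r i t d p body v rh Abody]; apply: trig_rule rh _ => b /Abody/AB.
Qed.

Lemma det_inl J f : det J f -> exists s a, f = @Fact R (hat_schema R E I) (inl s) a.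
Proof. by case=> [g _|h body v y _ _]; eexists; eexists. Qed.

Lemma det_dist_fact J k y : ~ det J (dist_fact k y).
Proof. by move=> /det_inl[s [a]]. Qed.

Lemma det_facts_over J : det J `<=` facts_over G.
Proof. by move=> f /det_inl[s [a ->]]. Qed.

Lemma trig_facts_over J k y : trig J k -> facts_over G (dist_fact k y).
Proof. by move=> [r i t d p body v rh _]; exists t, p, body. Qed.

(* The variable [None] does not occur in the head of a rule without
   existential quantifier. *)
Lemma det_head_indep h body : hat_rules G (XRule (atom_inl _ h) body) ->
  forall (v : nat -> R) y y',
    ground (oapp v y) (atom_inl (dschema R I) h) = ground (oapp v y') (atom_inl _ h).
Proof.
move Eth : (XRule _ _) => th rth v y y'.
have {Eth} hE : xrule_head th = atom_inl (dschema R I) h by rewrite -Eth.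
case: rth hE => [a b _|r i t d p b _|s _] /= hE; rewrite -?hE.
- congr Fact; apply: eq_from_tnth => j; rewrite !tnth_map.
  by case: (tnth _ _).
- by have := congr1 (@atom_sym _ _ _) hE.
- by congr Fact; apply: eq_from_tnth => j; rewrite !tnth_map !tnth_ord_tuple.
Qed.

Lemma solutionE J : solution G D J <->
  chase_solution dist_fact det trig (facts_over G) J.
Proof.
split=> [[JU DJ Jsat]|[JU dJ tJ]]; split=> //.
- move=> f [g Dg|h body v y rh Jbody]; first by apply: DJ; exists g.
  have [y' Jy'] := Jsat _ rh v Jbody.
  (* Satisfaction of the rule supplies its own dummy value [y'], which may differ from [y]. *)
  by rewrite (det_head_indep rh v y y').
- move=> k [r i t d p body v rh Jbody].
  have [y Jy] := Jsat _ (hat_exists rh) v Jbody.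
  by exists y; rewrite -ground_hat_head.
- by move=> f [g Dg <-]; apply: dJ; exact: det_input.
- move=> th rth v; case: rth (rth) => [a b _|r i t d p b rh|s _] rth Jbody.
  (* Any dummy value works here, since [det_rule] is available for all of them. *)
  + by exists 0; apply: dJ; apply: det_rule rth Jbody.
  + have [y Jy] := tJ _ (trig_rule rh Jbody).
    by exists y; rewrite /= ground_hat_head.
  + by exists 0; apply: dJ; apply: det_rule rth Jbody.
Qed.

Lemma possible_outcomesE :
  possible_outcomes G D = outcome dist_fact det trig trigger_mass.
Proof.
apply/seteqP.
suff H J : minimal_solution G D J <->
    exists c, J = chase dist_fact det trig (graph dist_fact c).
  split=> J [mJ Jpos]; split; [exact/H| |exact/H|] => [k y|s a].
    rewrite -weight_dist_fact; case: k => s t p; exact: Jpos.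
  by rewrite dist_factE => /Jpos.
rewrite -(minimal_chase_solutionP dist_fact_inj det_mono trig_mono det_dist_fact
   det_facts_over trig_facts_over J (inhabits 0)).
rewrite /minimal_solution/=; split=> -[/solutionE sJ Jmin]; split=> // J' /Jmin.
  by move=> + /solutionE.
by move=> + /solutionE.
Qed.

End Datalog.

Theorem theorem3p8 (R : realType) (Delta : set (pdist R))
    (Delta_finite : finite_set Delta) (E I : schema)
    (G : program Delta E I) (D : set (fact R E)) (D_finite : finite_set D) :
  possible_outcomes G D = finite_outcomes G D ->
  discrete_probability (possible_outcomes G D) (@prob R E I).
Proof.
move=> finO.
have outcome_finite J : outcome (@dist_fact R E I) (det G D) (trig G) (@trigger_mass R I) J ->
    finite_set J.
  by rewrite -possible_outcomesE finO => -[].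
rewrite possible_outcomesE.
apply: (outcome_probability (@dist_fact_inj R E I) (@det_mono R Delta E I G D)
  (@trig_mono R Delta E I G) (@det_dist_fact R Delta E I G D)
  (S := fun k => sample_space (dsym_dist (trig_sym k)))) => //.
- move=> k; exact: mass_prob.
- move=> k y; exact: mass_out.
- exact: weight_dist_fact.
(* Every fact over a distributional symbol is a [dist_fact], so only facts of weight 1 remain. *)
- case=> -[s|s] a nd; first by [].
  by case: (nd (trigger_of a) (sampled a)); exact: dist_factE.
Qed.
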